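(* Let $x>0$ and let $(\kappa_n)_{n\geqslant 1}$ be any sequence of integers with $\lim_{n\to\infty}\frac{\kappa_n}{n}=x$. Then $$\lim_{n\to\infty} n\,P(T_n=\kappa_n)=e^{-\gamma}\rho(x).$$
   Context: $\gamma$ is the Euler--Mascheroni constant. $\rho$ is the Dickman function: the continuous function on $[0,+\infty)$ with $\rho(x)=1$ for $0\leqslant x\leqslant 1$ and $x\rho'(x)+\rho(x-1)=0$ for $x>1$. $(Z_k)_{k\geqslant 1}$ are independent random variables with $P(Z_k=1)=\frac1k$ and $P(Z_k=0)=1-\frac1k$ for each $k$, and $T_n=\sum_{k=1}^n kZ_k$. *)

(* Defs.v *)
From HB Require Import structures.
From mathcomp Require Import all_boot all_order all_algebra finmap.
From mathcomp Require Import all_classical all_reals all_analysis.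
Import Order.TTheory GRing.Theory Num.Theory.
Import numFieldNormedType.Exports.

Set Implicit Arguments.
Unset Strict Implicit.
Unset Printing Implicit Defensive.

Local Open Scope classical_set_scope.
Local Open Scope ring_scope.

(* [series harmonic n] is the sum of 1/k for 1 <= k <= n. *)
Definition euler_gamma (R : realType) : R :=
  limn (fun n : nat => series harmonic n - ln n%:R).

(* Only the values of [rho] on [0, +oo[ are constrained; they are determined
   uniquely, so this predicate says that [rho] restricted to [0, +oo[ is the
   Dickman function. *)
Definition is_dickman (R : realType) (rho : R -> R) : Prop :=
  [/\ {within `[0, +oo[, continuous rho},
      forall x, 0 <= x <= 1 -> rho x = 1 &
      forall x, 1 < x ->
        derivable rho x 1 /\ x * derive1 rho x + rho (x - 1) = 0].

(* Mutual independence of the random variables [X i], for [i] in [D]. *)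
Definition independent_RVs (d d' : measure_display) (T : measurableType d)
    (T' : measurableType d') (R : realType) (P : probability T R)
    (I : choiceType) (D : set I) (X : I -> {RV P >-> T'}) : Prop :=
  forall (J : {fset I}) (B : I -> set T'),
    [set` J] `<=` D ->
    (forall i, i \in J -> measurable (B i)) ->
    P (\bigcap_(i in [set` J]) (X i @^-1` B i)) =
    (\prod_(i <- J) P (X i @^-1` B i))%E.

(* Main.v *)
(* Write [c_n(m) = n P(T_n = m+1)]; these are the coefficients of
   [W_n = \prod_(1 <= k < n) (1 + X^(k+1)/k)].  They lie in [0, 3], and
   [c_n(m)] does not depend on [n >= m]; call this value [c_m].

   The logarithmic derivative of [W_n] gives
   [m c_m = \sum_(j < m) c_j + O(log m)], which forces [c_m] to converge.
   The limit is found by Abel summation: as [z] tends to 1,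
   [(1 - z) W_n(z)] tends to the limit of [c_m], while comparing its logarithm
   with [ln (1 - z) = - \sum_k z^k/k] shows that it tends to [e^-gamma].

   Unfolding [c_(k+1)(m) = c_k(m) + c_k(m-k-1)/k] from [n] up to [m] gives
   [c_n(m) = c_m - \sum_(n <= k < m) c_k(m-k-1)/k], a discrete form of
   [rho(x) = 1 - \int_1^x rho(v-1)/v dv] under [v = m/k].  As the ratios
   [(m-k-1)/k] are at most [m/n - 1], induction on [N] shows that
   [c_n(m) - e^-gamma rho(m/n)] tends to 0 as [m] tends to infinity, uniformly
   in [n >= m/N]. *)
Require Import Defs.
From mathcomp Require Import all_boot all_order all_algebra finmap.
From mathcomp Require Import all_classical all_reals all_analysis.
From mathcomp Require Import ring lra zify.
Import Order.TTheory GRing.Theory Num.Theory.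
Import numFieldNormedType.Exports.

Set Implicit Arguments.
Unset Strict Implicit.
Unset Printing Implicit Defensive.

Local Open Scope classical_set_scope.
Local Open Scope ring_scope.

(** * Products over distinct part sizes *)

(** Generating polynomial of the partitions into distinct parts of size at most [n], a part of size
    [k.+1] having weight [w k]. *)
Definition partprod (R : comNzRingType) (w : nat -> R) (n : nat) : {poly R} :=
  \prod_(k < n) (1 + w k *: 'X^(k.+1)).

Definition partprod_but (R : comNzRingType) (w : nat -> R) (n i : nat) :
    {poly R} :=
  \prod_(k < n | k != i :> nat) (1 + w k *: 'X^(k.+1)).

Lemma coef_mul_factor (R : comNzRingType) (p : {poly R}) (a : R) (n m : nat) :
  (p * (1 + a *: 'X^(n.+1)))`_m =
  p`_m + (if (n < m)%N then a * p`_(m - n.+1) else 0).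
Proof.
rewrite mulrDr mulr1 coefD -scalerAr coefZ coefMXn ltnS.
by case: leqP => //= _; rewrite mulr0.
Qed.

Lemma partprodS (R : comNzRingType) (w : nat -> R) (n : nat) :
  partprod w n.+1 = partprod w n * (1 + w n *: 'X^(n.+1)).
Proof. by rewrite /partprod big_ord_recr. Qed.

Lemma partprod_butE (R : comNzRingType) (w : nat -> R) (n i : nat) :
  (i < n)%N -> partprod w n = partprod_but w n i * (1 + w i *: 'X^(i.+1)).
Proof.
move=> ltin; rewrite /partprod (bigD1 (Ordinal ltin)) //= mulrC.
by congr (_ * _); apply: eq_bigl => k; rewrite -val_eqE.
Qed.

Lemma partprod_butS (R : comNzRingType) (w : nat -> R) (n i : nat) :
  (i < n)%N ->
  partprod_but w n.+1 i = partprod_but w n i * (1 + w n *: 'X^(n.+1)).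
Proof.
move=> ltin; rewrite /partprod_but big_mkcond big_ord_recr /=.
by rewrite [in RHS]big_mkcond /= (gtn_eqF ltin).
Qed.

Lemma partprod_but_last (R : comNzRingType) (w : nat -> R) (n : nat) :
  partprod_but w n.+1 n = partprod w n.
Proof.
rewrite /partprod_but big_mkcond big_ord_recr /= eqxx mulr1.
by apply: eq_bigr => k _; rewrite (ltn_eqF (ltn_ord k)).
Qed.

(** The logarithmic derivative cleared of denominators: dividing by a factor becomes leaving it
    out. *)
Lemma partprod_deriv (R : comNzRingType) (w : nat -> R) (n : nat) :
  'X * (partprod w n)^`() =
  \sum_(i < n) (i.+1%:R * w i) *: (partprod_but w n i * 'X^(i.+1)).
Proof.
elim: n => [|n IHn]; first by rewrite /partprod !big_ord0 derivC mulr0.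
rewrite partprodS derivM mulrDr mulrA IHn big_ord_recr /= partprod_but_last.
congr (_ + _).
  rewrite mulr_suml; apply: eq_bigr => i _.
  by rewrite partprod_butS // -!scalerAl mulrAC.
rewrite derivD derivZ derivXn derivC add0r -scaler_nat scalerA -!scalerAr.
by rewrite mulrCA -exprS [w n * _]mulrC.
Qed.

Lemma partprod_coef (R : comNzRingType) (w : nat -> R) (n m : nat) :
  m%:R * (partprod w n)`_m =
  \sum_(i < n) (if (i < m)%N
    then i.+1%:R * w i * (partprod_but w n i)`_(m - i.+1) else 0).
Proof.
have -> : m%:R * (partprod w n)`_m = ('X * (partprod w n)^`())`_m.
  case: m => [|m]; first by rewrite mul0r coefXM.
  by rewrite coefXM /= coef_deriv mulr_natl.
rewrite partprod_deriv coef_sum; apply: eq_bigr => i _.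
by rewrite coefZ coefMXn ltnS; case: leqP; rewrite ?mulr0.
Qed.

Lemma partprod_but_coefE (R : comNzRingType) (w : nat -> R) (n m i : nat) :
  (i < n)%N -> (partprod w n)`_m = (partprod_but w n i)`_m +
    (if (i < m)%N then w i * (partprod_but w n i)`_(m - i.+1) else 0).
Proof. by move=> ltin; rewrite (partprod_butE w ltin) coef_mul_factor. Qed.

Lemma coef_prod_ge0 (R : realDomainType) (w : nat -> R) (r : seq nat)
    (Q : pred nat) (m : nat) :
  (forall k, 0 <= w k) -> 0 <= (\prod_(k <- r | Q k) (1 + w k *: 'X^(k.+1)))`_m.
Proof.
move=> w_ge0; elim: r m => [|k r IHr] m.
  by rewrite big_nil coef1 ler0n.
rewrite big_cons; case: ifP => // _.
by rewrite mulrC coef_mul_factor; case: ifP => _;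
  rewrite ?addr0 // addr_ge0 ?mulr_ge0.
Qed.

Lemma partprod_ge0 (R : realDomainType) (w : nat -> R) (n m : nat) :
  (forall k, 0 <= w k) -> 0 <= (partprod w n)`_m.
Proof.
by move=> w_ge0; rewrite /partprod -
  (big_mkord xpredT (fun k => 1 + w k *: 'X^(k.+1))) coef_prod_ge0.
Qed.

Lemma partprod_but_ge0 (R : realDomainType) (w : nat -> R) (n i m : nat) :
  (forall k, 0 <= w k) -> 0 <= (partprod_but w n i)`_m.
Proof.
by move=> w_ge0; rewrite /partprod_but -
  (big_mkord (fun k => k != i) (fun k => 1 + w k *: 'X^(k.+1))) coef_prod_ge0.
Qed.

Lemma partprod_but_le (R : realDomainType) (w : nat -> R) (n i m : nat) :
  (forall k, 0 <= w k) -> (i < n)%N ->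
  (partprod_but w n i)`_m <= (partprod w n)`_m.
Proof.
move=> w_ge0 ltin; rewrite (partprod_but_coefE w _ ltin) lerDl.
by case: ifP => // _; rewrite mulr_ge0 // partprod_but_ge0.
Qed.

(* The coefficient is the proportion of permutations of [m] points with
   distinct cycle lengths, all at most [n]. *)
Lemma partprod_harmonic_le1 (R : realFieldType) (n m : nat) :
  (partprod (fun k => k.+1%:R^-1 : R) n)`_m <= 1.
Proof.
set w := fun k => _; have w_ge0 k : 0 <= w k by rewrite /w invr_ge0.
elim/ltn_ind: m => m IHm; case: (posnP m) => [-> | m_gt0].
  elim: n {IHm} => [|n IHn]; first by rewrite /partprod big_ord0 coef1.
  by rewrite partprodS coef_mul_factor ltn0 addr0.
(* Here [i.+1%:R * w i = 1], so [m] times the coefficient is a sum of at most [m] coefficients of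
   smaller index, each with one factor left out and hence at most 1 by induction. *)
suff : m%:R * (partprod w n)`_m <= m%:R * 1 by rewrite ler_pM2l ?ltr0n.
rewrite partprod_coef mulr1.
have -> : m%:R = \sum_(i < m) 1 :> R by rewrite sumr_const card_ord.
apply: (@le_trans _ _ (\sum_(i < n) (if (i < m)%N then 1 else 0))).
  apply: ler_sum => i _; case: ifP => // ltim.
  rewrite /w divff ?pnatr_eq0 // mul1r.
  apply: le_trans (partprod_but_le _ w_ge0 (ltn_ord i)) _.
  by apply: IHm; lia.
rewrite -(big_mkord xpredT (fun i => if (i < m)%N then 1 else 0)) -big_mkcond.
rewrite -(big_mkord xpredT (fun=> 1)) /=.
case: (leqP n m) => [lenm|ltmn].
  rewrite (@big_cat_nat _ _ _ n 0 m) //= big_nat_cond.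
  rewrite [X in _ <= X + _]big_nat_cond.
  rewrite -[leLHS]addr0; apply: lerD; last by rewrite sumr_ge0.
  rewrite le_eqVlt; apply/orP; left; apply/eqP; apply: eq_bigl => i.
  by lia.
rewrite (@big_cat_nat _ _ _ m 0 n) //=; last exact: ltnW.
rewrite [X in _ + X]big_nat_cond [X in _ + X]big1 => [|i]; last by lia.
rewrite addr0 big_nat_cond [leRHS]big_nat_cond.
rewrite le_eqVlt; apply/orP; left; apply/eqP; apply: eq_bigl => i.
by lia.
Qed.

(** * The coefficients of [W_n] *)

(** Factor by factor, [(1 + a X^j)(1 + b X^j)] dominates [1 + (a + b) X^j], the extra term having a
    nonnegative coefficient. *)
Lemma partprod_le_mul (R : realDomainType) (w a b : nat -> R) (n m : nat) :
  (forall k, 0 <= w k) -> (forall k, 0 <= a k) -> (forall k, 0 <= b k) ->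
  (forall k, w k <= a k + b k) ->
  (partprod w n)`_m <= (partprod a n * partprod b n)`_m.
Proof.
move=> w_ge0 a_ge0 b_ge0 le_w.
have ab_ge0 i j : 0 <= (partprod a i * partprod b i)`_j.
  by rewrite coefM sumr_ge0 // => k _; rewrite mulr_ge0 ?partprod_ge0.
elim: n m => [|n IHn] m; first by rewrite /partprod !big_ord0 mulr1.
rewrite !partprodS mulrACA mulrA !coef_mul_factor.
move: (partprod a n * partprod b n) (IHn) (ab_ge0 n) => p IHp p_ge0.
case: ifP => ltnm; last by rewrite !addr0 IHp.
rewrite -addrA lerD ?IHp // mulrDr addrA -mulrDl.
apply: le_trans (_ : (a n + b n) * p`_(m - n.+1) <= _).
  by rewrite ler_pM ?partprod_ge0.
by rewrite lerDl mulr_ge0 //; case: ifP => // _; rewrite mulr_ge0.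
Qed.

Lemma coef_mul_le_horner1 (R : realDomainType) (p q : {poly R}) (m : nat) :
  (forall j, p`_j <= 1) -> (forall j, 0 <= q`_j) -> (p * q)`_m <= q.[1].
Proof.
move=> p_le1 q_ge0; rewrite coefMr.
apply: (@le_trans _ _ (\sum_(j < m.+1) q`_j)).
  by apply: ler_sum => j _; rewrite ler_piMl.
rewrite (@horner_coef_wide _ (m.+1 + size q)) ?leq_addl // big_split_ord /=.
rewrite -[leLHS]addr0 lerD //.
  by apply: ler_sum => j _; rewrite expr1n mulr1.
by rewrite sumr_ge0 // => j _; rewrite expr1n mulr1.
Qed.

(* [pmf_coef R n m] is [n P(T_n = m+1)], see [pmfE]; as [0^-1 = 0] the factor of
   index [k = 0] is 1. *)
Definition pmf_coef (R : realFieldType) (n m : nat) : R :=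
  (partprod (fun k => k%:R^-1) n)`_m.

Lemma pmf_coef_ge0 (R : realFieldType) (n m : nat) : 0 <= pmf_coef R n m.
Proof. by rewrite partprod_ge0 // => k; rewrite invr_ge0. Qed.

Lemma pmf_coefS (R : realFieldType) (n m : nat) :
  pmf_coef R n.+1 m = pmf_coef R n m +
    (if (n < m)%N then n%:R^-1 * pmf_coef R n (m - n.+1) else 0).
Proof. by rewrite /pmf_coef partprodS coef_mul_factor. Qed.

(* [1/k = 1/(k+1) + 1/(k(k+1))]: the first summands give coefficients at most
   1, the second ones a convergent product. *)
Lemma pmf_coef_le3 (R : realFieldType) (n m : nat) : pmf_coef R n m <= 3.
Proof.
pose a k : R := k.+1%:R^-1; pose b k : R := (k * k.+1)%:R^-1.
have a_ge0 k : 0 <= a k by rewrite invr_ge0.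
have b_ge0 k : 0 <= b k by rewrite invr_ge0.
apply: (@le_trans _ _ (partprod a n * partprod b n)`_m).
  have w_ge0 k : 0 <= k%:R^-1 :> R by rewrite invr_ge0.
  apply: partprod_le_mul => // -[|k]; first by rewrite invr0 addr_ge0.
  rewrite le_eqVlt; apply/orP; left; apply/eqP; rewrite /a /b natrM.
  have k_ge0 : 0 <= k%:R :> R by [].
  by field; apply/andP; split; apply: lt0r_neq0; lra.
apply: (@le_trans _ _ (partprod b n).[1]).
  apply: coef_mul_le_horner1 => j; first exact: partprod_harmonic_le1.
  exact: partprod_ge0.
rewrite /partprod horner_prod.
under eq_bigr do rewrite hornerD hornerZ hornerXn expr1n mulr1 hornerC.
case: n => [|[|n]]; first by rewrite big_ord0 ler1n.
  by rewrite big_ord1 /b mul0n invr0 addr0 ler1n.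
(* The constant 3 alone does not pass through an induction; this sharper bound does, with equality
   for two factors. *)
apply: (@le_trans _ _ (3 * (1 - n.+2%:R^-1))); last first.
  by rewrite ler_piMr // gerBl invr_ge0.
elim: n => [|n IHn].
  by rewrite big_ord_recr big_ord1 /b /= mul0n mul1n invr0; lra.
rewrite big_ord_recr /=; apply: le_trans (ler_wpM2r _ IHn) _.
  by rewrite addr_ge0.
rewrite /b natrM -subr_ge0.
have n_ge0 : 0 <= n%:R :> R by [].
rewrite (_ : _ - _ = 3 * (n.+2%:R ^- 2 * n.+3%:R^-1)) ?mulr_ge0 ?invr_ge0
  ?exprn_ge0//.
by field; apply/andP; split; apply: lt0r_neq0; lra.
Qed.

Lemma pmf_coef_stable (R : realFieldType) (n m : nat) :
  (m <= n)%N -> pmf_coef R n m = pmf_coef R m m.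
Proof.
move=> /subnKC <-; elim: (n - m)%N => [|k IHk]; first by rewrite addn0.
by rewrite addnS pmf_coefS IHk ltnNge leq_addr addr0.
Qed.

Lemma pmf_coef_telescope (R : realFieldType) (n m : nat) : (n <= m)%N ->
  pmf_coef R n m = pmf_coef R m m -
    \sum_(n <= k < m) k%:R^-1 * pmf_coef R k (m - k.+1).
Proof.
move=> lenm; apply/eqP; rewrite eq_sym subr_eq; apply/eqP.
have [k le_km ->] : exists2 k, (k <= m - n)%N & n = (m - k)%N.
  by exists (m - n)%N; lia.
elim: k le_km => [|k IHk] le_km; first by rewrite subn0 big_geq ?addr0.
rewrite big_ltn; last by lia.
rewrite IHk; last by lia.
have -> : (m - k = (m - k.+1).+1)%N by lia.
rewrite pmf_coefS addrA; congr (_ + _).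
by rewrite ifT //; lia.
Qed.

(* Removing a factor in the logarithmic derivative costs at most a multiple of
   its weight. *)
Lemma pmf_coef_mean (R : realFieldType) (m : nat) :
  `| m%:R * pmf_coef R m m - \sum_(j < m) pmf_coef R j j |
    <= 3 * (1 + \sum_(k < m) k%:R^-1).
Proof.
set w := fun k : nat => k%:R^-1 : R.
have w_ge0 k : 0 <= w k by rewrite invr_ge0.
have but_le i j : (i < m)%N -> (partprod_but w m i)`_j <= 3.
  by move=> ltim; apply: le_trans (pmf_coef_le3 R m j);
    exact: partprod_but_le.
rewrite /pmf_coef partprod_coef.
rewrite -(big_mkord xpredT (fun j => (partprod w j)`_j)) big_nat_rev /= add0n.
rewrite big_mkord -sumrB.
(* The weight of index 0 is [0^-1 = 0], while the reversed sum has the term [c_(m-1)] there; this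
   costs 3. *)
apply: (@le_trans _ _ (\sum_(i < m) ((i == 0 :> nat)%:R * 3 + 3 * w i))).
  apply: le_trans (ler_norm_sum _ _ _) _; apply: ler_sum => i _.
  rewrite ltn_ord -/w.
  have -> : (partprod w (m - i.+1))`_(m - i.+1) = (partprod w m)`_(m - i.+1).
    by rewrite -[LHS](@pmf_coef_stable R m) // leq_subr.
  have := partprod_ge0 m (m - i.+1) w_ge0.
  have := pmf_coef_le3 R m (m - i.+1); rewrite /pmf_coef -/w.
  case: (posnP i) => [i0|i_gt0].
    rewrite i0 /= {1}/w invr0 mulr0 mul0r sub0r normrN mul1r => le3 ge0.
    by rewrite ger0_norm // /w invr0 mulr0 addr0.
  move=> _ _; rewrite (partprod_but_coefE _ (m - i.+1) (ltn_ord i)).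
  rewrite /= mul0r add0r.
  (* The summand 1 cancels the leading part of [c_(m-i-1)]; what remains is [w i] times a difference
     of two numbers in [0, 3]. *)
  have wE : i.+1%:R * w i = 1 + w i.
    by rewrite -natr1 mulrDl divff ?mul1r // pnatr_eq0 -lt0n.
  rewrite wE mulrDl mul1r opprD addrACA subrr add0r.
  have [le3 ge0] := (but_le i (m - i.+1)%N (ltn_ord i), partprod_but_ge0 m i
    (m - i.+1) w_ge0).
  have w0 := w_ge0 i.
  case: ifP => _.
    have [le3' ge0'] := (but_le i (m - i.+1 - i.+1)%N (ltn_ord i),
      partprod_but_ge0 m i (m - i.+1 - i.+1) w_ge0).
    rewrite -mulrBr normrM ger0_norm // mulrC ler_wpM2r //.
    by rewrite ler_norml; apply/andP; split; lra.
  by rewrite subr0 ger0_norm ?mulr_ge0 // mulrC ler_wpM2r.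
rewrite big_split /= -mulr_sumr mulrDr lerD // mulr1 -mulr_suml.
rewrite ler_piMl // -(big_mkord xpredT (fun i => (i == 0)%:R)) /=.
case: m {but_le} => [|m]; first by rewrite big_geq.
by rewrite big_nat_recl // big1 ?addr0.
Qed.

(** * Convergence of the stable coefficients *)

(** [A - V] is nondecreasing, [A + V] is nonincreasing and their distance tends to 0, so they are
    adjacent sequences. *)
Lemma cvg_of_dominated_increments (R : realType) (A V : nat -> R) :
  (forall m, `|A m.+1 - A m| <= V m - V m.+1) -> V @ \oo --> 0 -> cvgn A.
Proof.
move=> AV V0; have ub m : A m.+1 + V m.+1 <= A m + V m.
  by have := AV m; rewrite ler_norml => /andP[_]; lra.
have lb m : A m - V m <= A m.+1 - V m.+1.
  by have := AV m; rewrite ler_norml => /andP[]; lra.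
have [|||_ cvgAV _] :=
  @adjacent_seq R (fun m => A m - V m) (fun m => A m + V m).
- exact/nondecreasing_seqP.
- exact/nonincreasing_seqP.
- rewrite (_ : _ - _ = V + V); last by apply/funext => m /=; rewrite !fctE; lra.
  by rewrite -[0]addr0; apply: cvgD.
rewrite (_ : A = (fun m => A m - V m) + V); last first.
  by apply/funext => m; rewrite fctE subrK.
by apply: is_cvgD => //; apply: cvgP V0.
Qed.

Lemma cvg_harmonic_mean (R : realType) :
  (fun m => (\sum_(k < m.+1) k%:R^-1 + 2) / m.+1%:R : R) @ \oo --> 0.
Proof.
have cv : arithmetic_mean (@harmonic R) +
  (2 : R) *: (@harmonic R) @ \oo --> 0 + 2 *: (0 : R).
  by apply: cvgD; [apply: cesaro; exact: cvg_harmonic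
                  | apply: cvgZr; exact: cvg_harmonic].
rewrite scaler0 addr0 in cv.
apply: squeeze_cvgr _ cv; first last.
  exact: (cvg_cst 0).
near=> m; apply/andP; split.
  by rewrite divr_ge0 // addr_ge0 // sumr_ge0.
rewrite mulrDl fctE /arithmetic_mean /= lerD // mulrC ler_wpM2l //.
rewrite big_ord_recl invr0 add0r /series /= big_nat_recr //=.
by rewrite big_mkord lerDl.
Unshelve. all: by end_near. Qed.

(** By [pmf_coef_mean], [c_(m+1)] is within O(log m / m) of the mean [A m] of the earlier
    coefficients. The increments of [A] are smaller by a factor [m + 2], so [A] converges, and [c]
    with it. *)
Lemma pmf_coef_cvg (R : realType) : cvgn (fun m => pmf_coef R m m).
Proof.
pose c m := pmf_coef R m m; pose h m : R := \sum_(k < m) k%:R^-1.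
pose A m := (\sum_(j < m.+1) c j) / m.+1%:R.
(* The summand 2 makes [V m - V m.+1] equal to [3 (h m.+1 + 1) / ((m + 1)(m + 2))], which is the
   bound on the increments of [A]. *)
pose V m := 3 * ((h m.+1 + 2) / m.+1%:R).
have V0 : V @ \oo --> 0.
  rewrite -[X in _ --> X](mulr0 (3 : R)).
  by apply: cvgMr; exact: cvg_harmonic_mean.
have h_ge0 m : 0 <= h m by rewrite sumr_ge0.
have near_mean m : `|c m.+1 - A m| <= 3 * ((h m.+1 + 1) / m.+1%:R).
  have m_gt0 : (0 : R) < m.+1%:R by [].
  rewrite mulrA ler_pdivlMr // -{1}(gtr0_norm m_gt0) -normrM mulrBl.
  rewrite /A divfK ?lt0r_neq0 // mulrC [h _ + 1]addrC.
  exact: pmf_coef_mean.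
have cvgA : cvgn A.
  apply: cvg_of_dominated_increments V0 => m.
  have -> : A m.+1 - A m = (c m.+1 - A m) / m.+2%:R.
    rewrite /A big_ord_recr /=; move: (\sum_(_ < _) _) => s.
    have m_ge0 : 0 <= m%:R :> R by [].
    by field; apply/andP; split; apply: lt0r_neq0; lra.
  rewrite normrM normfV (gtr0_norm (ltr0Sn _ _)).
  apply: le_trans (ler_wpM2r _ (near_mean m)) _; first by rewrite invr_ge0.
  rewrite /V /h [in X in _ <= _ - X]big_ord_recr /= -/(h _).
  have m_ge0 : 0 <= m%:R :> R by [].
  rewrite le_eqVlt; apply/orP; left; apply/eqP.
  by field; apply/andP; split; apply: lt0r_neq0; lra.
have diff0 : (fun m => c m.+1 - A m) @ \oo --> 0.
  apply/norm_cvg0P; apply: squeeze_cvgr _ V0; last exact: (cvg_cst 0).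
  apply: nearW => m; rewrite normr_ge0 (le_trans (near_mean m)) //.
  rewrite ler_wpM2l // ler_wpM2r ?invr_ge0 //; lra.
suff : cvgn (fun m => c m.+1) by move=> /cvg_ex[l]; rewrite cvg_shiftS => /cvgP.
rewrite (_ : (fun m => _) = (fun m => c m.+1 - A m) + A); last first.
  by apply/funext => m; rewrite fctE subrK.
by apply: is_cvgD cvgA; apply: cvgP diff0.
Qed.

(** * The limit is [e^-gamma] *)

(** Both bounds come from [ln (1 + x) <= x], taken at [x = - t] and at [x = t / (1 - t)]. *)
Lemma ln1B_bounds (R : realType) (t : R) : 0 <= t < 1 ->
  - (t ^+ 2 / (1 - t)) <= ln (1 - t) + t <= 0.
Proof.
move=> /andP[t_ge0 t_lt1].
have u_gt0 : 0 < 1 - t by lra.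
have le1 : ln (1 - t) <= - t by apply: le_ln1Dx; lra.
have le2 : ln (1 - t)^-1 <= t / (1 - t).
  rewrite [X in ln X](_ : _ = 1 + t / (1 - t)); last first.
    by field; rewrite lt0r_neq0.
  by apply: le_ln1Dx; apply: lt_le_trans (_ : 0 <= _);
    rewrite ?ltrN10 ?divr_ge0 // ltW.
rewrite lnV ?posrE // in le2.
have E : t ^+ 2 / (1 - t) = t / (1 - t) - t by field; rewrite lt0r_neq0.
by rewrite E; apply/andP; split; lra.
Qed.

(** A [limn] is meaningful only once convergence is known. [ln1B_bounds] at [t = 1/(m+2)] bounds the
    increments by [1/(m+1) - 1/(m+2)]. *)
Lemma euler_gamma_cvg (R : realType) :
  (fun n : nat => series harmonic n - ln n%:R) @ \oo --> euler_gamma R.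
Proof.
suff cv : cvgn (fun n : nat => series harmonic n - ln n%:R : R) by exact: cv.
suff : cvgn (fun n : nat => series harmonic n.+1 - ln n.+1%:R : R).
  by move=> /cvg_ex[l]; rewrite (cvg_shiftS (fun n => _ n - _)) => /cvgP.
apply: cvg_of_dominated_increments (@cvg_harmonic R) => m.
have m_ge0 : 0 <= m%:R :> R by [].
rewrite /series /= [in X in `|X - _|]big_nat_recr //=.
set s := \sum_(_ <= _ < _) _.
have lnE : ln m.+1%:R - ln m.+2%:R = ln (1 - m.+2%:R^-1) :> R.
  by rewrite -ln_div ?posrE //; congr ln; field; apply: lt0r_neq0; lra.
have t01 : 0 <= (m.+2%:R^-1 : R) < 1.
  by rewrite invr_ge0 ler0n invf_lt1 ?ltr1n.
have E : m.+2%:R^-1 ^+ 2 / (1 - m.+2%:R^-1) = m.+1%:R^-1 - m.+2%:R^-1 :> R.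
  by field; rewrite !lt0r_neq0 //; lra.
have := ln1B_bounds t01; rewrite E -lnE => /andP[lo hi].
have le_inv : m.+2%:R^-1 <= m.+1%:R^-1 :> R.
  by rewrite lef_pV2 ?posrE // ler_nat.
rewrite /= ler_norml; clear E lnE t01 m_ge0; move: s lo hi le_inv.
move: (ln m.+1%:R) (ln m.+2%:R) m.+1%:R^-1 m.+2%:R^-1 => a b u v s lo hi le_inv.
by apply/andP; split; lra.
Qed.

Lemma ln1B_poly_MVT (R : realType) (q : {poly R}) (z : R) : 0 <= z < 1 ->
  exists2 c, 0 <= c <= z &
    ln (1 - z) + q.[z] - q.[0] = (q^`().[c] - (1 - c)^-1) * z.
Proof.
move=> /andP[z_ge0 z_lt1].
pose F (t : R) := ln (1 - t) + q.[t].
have dF (t : R) : t < 1 -> is_derive t 1 F (q^`().[t] - (1 - t)^-1).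
  move=> t_lt1; have u_gt0 : 0 < 1 - t by lra.
  have d1 : @is_derive R R R t 1 (cst 1 - id) (0 - 1) by exact: is_deriveB.
  have d2 : is_derive ((cst 1 - id : R -> R) t) 1 (@ln R) (1 - t)^-1.
    exact: is_derive1_ln.
  have d3 := @is_derive1_comp _ _ _ _ _ _ d2 d1.
  have := @is_deriveD _ _ _ _ _ t 1 _ _ d3 (@is_derive_poly R q t).
  by rewrite sub0r mulrN mulr1 [- _ + _]addrC.
have [|||c] := @MVT_segment R F (fun t => q^`().[t] - (1 - t)^-1) 0 z.
- by [].
- by move=> x; rewrite in_itv /= => /andP[_ ltxz]; apply: dF; lra.
- apply: derivable_within_continuous => x; rewrite in_itv /= => /andP[_ lexz].
  by have [] := dF x (le_lt_trans lexz z_lt1).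
rewrite in_itv /= => czP; rewrite /F !subr0 ln1 add0r => ->.
by exists c.
Qed.

(** The truncated series has derivative [(1 - t^n) / (1 - t)], so adding it to [ln (1 - t)] leaves
    the derivative [- t^n / (1 - t) <= 0]; this gives the upper bound. *)
Lemma ln1B_series_bounds (R : realType) (n : nat) (z : R) : 0 <= z < 1 ->
  - (n.+1%:R * (1 - z))^-1 <=
    ln (1 - z) + \sum_(k < n) k.+1%:R^-1 * z ^+ k.+1 <= 0.
Proof.
move=> z01; have /andP[z_ge0 z_lt1] := z01.
pose p : {poly R} := \sum_(k < n) k.+1%:R^-1 *: 'X^(k.+1).
have pE t : p.[t] = \sum_(k < n) k.+1%:R^-1 * t ^+ k.+1.
  by rewrite horner_sum; apply: eq_bigr => k _; rewrite hornerZ hornerXn.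
have dpE t : t < 1 -> p^`().[t] = (1 - t ^+ n) / (1 - t).
  move=> t_lt1; have u_neq0 : 1 - t != 0 by rewrite lt0r_neq0 // subr_gt0.
  apply: (canRL (mulfK u_neq0)); rewrite raddf_sum /= horner_sum mulrC.
  rewrite -[1 - t]opprB mulNr -[RHS]opprB subrX1; congr (- (_ * _)).
  apply: eq_bigr => k _; rewrite derivZ derivXn hornerZ hornerMn hornerXn.
  by rewrite -[X in _ * X]mulr_natl mulrA mulVf ?mul1r // pnatr_eq0.
have p0 : p.[0] = 0.
  by rewrite pE big1 // => k _; rewrite expr0n /= mulr0.
rewrite -pE; apply/andP; split; last first.
  have [c /andP[c_ge0 lecz]] := ln1B_poly_MVT p z01.
  rewrite p0 subr0 => ->; rewrite dpE; last by lra.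
  rewrite -[X in _ - X]mul1r -mulrBl addrAC subrr add0r mulNr mulNr.
  by rewrite oppr_le0 !mulr_ge0 ?exprn_ge0 // invr_ge0; lra.
(* For the lower bound the added monomial, with [z] fixed in its coefficient, turns the derivative
   at [c] into [c^n (1/(1-z) - 1/(1-c))], nonnegative for [c <= z]. *)
pose q := p + (n.+1%:R * (1 - z))^-1 *: 'X^(n.+1).
have u_gt0 : 0 < 1 - z by lra.
have [c /andP[c_ge0 lecz]] := ln1B_poly_MVT q z01.
have -> : q.[0] = 0 by rewrite hornerD p0 hornerZ hornerXn expr0n mulr0 addr0.
have -> : q^`().[c] = (1 - c ^+ n) / (1 - c) + (1 - z)^-1 * c ^+ n.
  rewrite derivD hornerD dpE; last by lra.
  rewrite derivZ derivXn hornerZ hornerMn hornerXn.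
  rewrite -[X in _ + _ * X]mulr_natl mulrA; congr (_ + _ * _).
  by rewrite invfM mulrC mulrA divff ?mul1r // pnatr_eq0.
rewrite subr0 => E.
have : 0 <= ln (1 - z) + q.[z].
  rewrite E mulr_ge0 //.
  rewrite (_ : _ - _ = c ^+ n * ((1 - z)^-1 - (1 - c)^-1)); last first.
    by field; rewrite !lt0r_neq0 //; lra.
  rewrite mulr_ge0 ?exprn_ge0 // subr_ge0 lef_pV2 ?posrE; lra.
rewrite hornerD hornerZ hornerXn => ge0.
rewrite -subr_ge0 opprK -addrA; apply: le_trans ge0 _.
rewrite lerD2l lerD2l ler_piMr ?exprn_ile1 // ?invr_ge0 ?mulr_ge0 //; lra.
Qed.

(** For [k >= 1], [1 + z^(k+1)/k] is [(k+1)/k] times [1 - (1 - z^(k+1))/(k+1)], and the factors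
    [(k+1)/k] multiply to [n]. The factor of index 0 is 1, so its summand [1 - z] stays alone on the
    right. *)
Lemma pmf_horner_ln (R : realType) (n : nat) (z : R) : (0 < n)%N ->
  0 <= z <= 1 ->
  0 < (partprod (fun k => k%:R^-1) n).[z] /\
  ln (partprod (fun k => k%:R^-1) n).[z] - ln n%:R
    + \sum_(k < n) (1 - z ^+ k.+1) / k.+1%:R
  = 1 - z + \sum_(1 <= k < n)
      (ln (1 - (1 - z ^+ k.+1) / k.+1%:R) + (1 - z ^+ k.+1) / k.+1%:R).
Proof.
move=> + /andP[z_ge0 z_le1]; case: n => // n _; elim: n => [|n [IHpos IHn]].
  rewrite partprodS /partprod big_ord0 mul1r invr0 scale0r addr0 hornerC.
  by rewrite big_ord1 big_geq // ln1 subrr invr1 mulr1 expr1 add0r addr0.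
have zn_ge0 : 0 <= z ^+ n.+2 by rewrite exprn_ge0.
have n_ge0 : 0 <= n%:R :> R by [].
have f_gt0 : 0 < 1 + n.+1%:R^-1 * z ^+ n.+2.
  by rewrite ltr_wpDr // mulr_ge0 // invr_ge0.
rewrite partprodS hornerM hornerD hornerC hornerZ hornerXn mulr_gt0 //.
split=> //; rewrite big_ord_recr big_nat_recr //= [in RHS]addrA -IHn lnM
  ?posrE //.
have -> : ln (1 - (1 - z ^+ n.+2) / n.+2%:R) =
    ln n.+1%:R + ln (1 + n.+1%:R^-1 * z ^+ n.+2) - ln n.+2%:R :> R.
  rewrite -lnM ?posrE // -ln_div ?posrE ?mulr_gt0 //; congr ln.
  by field; rewrite !lt0r_neq0 //; lra.
ring.
Qed.

Lemma one_sub_exp_bounds (R : realFieldType) (z : R) (k : nat) :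
  0 <= z <= 1 -> 0 <= 1 - z ^+ k <= 1 /\ 1 - z ^+ k <= k%:R * (1 - z).
Proof.
move=> /andP[z_ge0 z_le1].
have zk0 i : 0 <= z ^+ i by rewrite exprn_ge0.
have zk1 i : z ^+ i <= 1 by rewrite exprn_ile1.
split; first by rewrite subr_ge0 zk1 gerBl zk0.
rewrite -[1 - _]opprB subrX1 -mulNr opprB mulrC ler_wpM2r ?subr_ge0 //.
rewrite -[leRHS]mulr1 -[X in X%:R]card_ord mulr_natl -sumr_const.
by apply: ler_sum => i _.
Qed.

(** The bound is uniform in [n]: the terms [ln (1 - t) + t] are of order [t^2] and sum to at most
    [8/j] in absolute value, and [1 - z] adds [1/j]. *)
Lemma pmf_horner_ln_bound (R : realType) (j n : nat) (z : R) :
  (0 < n)%N -> (0 < j)%N -> z = 1 - j%:R^-1 ->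
  `|ln (partprod (fun k => k%:R^-1) n).[z] - ln n%:R
    + \sum_(k < n) (1 - z ^+ k.+1) / k.+1%:R| <= 9 / j%:R.
Proof.
move=> n_gt0 j_gt0 zE.
have j0 : 0 < j%:R :> R by rewrite ltr0n.
have j1 : 1 <= j%:R :> R by rewrite ler1n.
have ji1 : j%:R^-1 <= 1 :> R by rewrite invf_le1.
have ji0 : 0 < j%:R^-1 :> R by rewrite invr_gt0.
have z01 : 0 <= z <= 1 by rewrite zE; lra.
have [_ ->] := pmf_horner_ln n_gt0 z01.
have term k : (0 < k)%N ->
    - (8 * ((k + j)%:R^-1 - (k.+1 + j)%:R^-1)) <=
    ln (1 - (1 - z ^+ k.+1) / k.+1%:R) + (1 - z ^+ k.+1) / k.+1%:R <= 0.
  move=> k_gt0; have [/andP[u0 u1] uk] := one_sub_exp_bounds k.+1 z01.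
  set t := (1 - _) / _.
  have k1 : 1 <= k%:R :> R by rewrite ler1n.
  have k10 : 0 < k.+1%:R :> R by [].
  have t0 : 0 <= t by rewrite divr_ge0.
  have tk : t <= k.+1%:R^-1 by rewrite ler_piMl // invr_ge0.
  have tj : t <= j%:R^-1.
    rewrite ler_pdivrMr // mulrC (_ : j%:R^-1 = 1 - z) //; rewrite zE; lra.
  clearbody t.
  have t2 : t <= 2^-1.
    by apply: le_trans tk _; rewrite lef_pV2 ?posrE // -natr1; lra.
  have t01 : 0 <= t < 1 by apply/andP; split => //; lra.
  have /andP[lo hi] := ln1B_bounds t01.
  apply/andP; split=> //; apply: le_trans lo; rewrite lerN2.
  have : t ^+ 2 / (1 - t) <= 2 * t ^+ 2.
    rewrite ler_pdivrMr; last by lra.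
    rewrite mulrAC ler_peMl ?exprn_ge0 //; lra.
  move=> /le_trans; apply.
  (* [t] is at most the inverse of the larger of [k + 1] and [j], and [k + 1 + j] is at most twice
     that number. The right-hand side is chosen to telescope in [k]. *)
  suff : t ^+ 2 <= 4 * ((k + j)%:R^-1 - (k.+1 + j)%:R^-1) by lra.
  have -> : (k + j)%:R^-1 - (k.+1 + j)%:R^-1
      = ((k%:R + j%:R) * (k%:R + j%:R + 1))^-1 :> R.
    by rewrite addSn -natr1 natrD; field; rewrite !lt0r_neq0; lra.
  have kj_gt0 : 0 < (k%:R + j%:R) * (k%:R + j%:R + 1) :> R.
    by rewrite mulr_gt0; lra.
  rewrite ler_pdivlMr //.
  have [lekj|ltjk] := leP (k%:R + 1) (j%:R : R).
    have jt : j%:R * t <= 1 by rewrite mulrC -ler_pdivlMr // mul1r.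
    have jt2 : (j%:R * t) ^+ 2 <= 1 by rewrite exprn_ile1 // mulr_ge0 // ltW.
    apply: le_trans (_ : 4 * (j%:R * t) ^+ 2 <= _); last by lra.
    by rewrite exprMn [leRHS]mulrA [leLHS]mulrC ler_wpM2r ?exprn_ge0 //; nra.
  have kt : k.+1%:R * t <= 1 by rewrite mulrC -ler_pdivlMr // mul1r.
  have kt2 : (k.+1%:R * t) ^+ 2 <= 1 by rewrite exprn_ile1 // mulr_ge0.
  apply: le_trans (_ : 4 * (k.+1%:R * t) ^+ 2 <= _); last by lra.
  by rewrite exprMn [leRHS]mulrA [leLHS]mulrC ler_wpM2r ?exprn_ge0 // -natr1;
    nra.
set S := \sum_(1 <= k < n) _.
have [lo hi] : - (8 * \sum_(1 <= k < n) ((k + j)%:R^-1 - (k.+1 + j)%:R^-1)) <= S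
    /\ S <= 0.
  split; first rewrite mulr_sumr -sumrN; rewrite ?/S.
    rewrite big_nat_cond [leRHS]big_nat_cond; apply: ler_sum => k.
    by rewrite andbT => /andP[/term/andP[]].
  rewrite big_nat_cond -oppr_ge0 -sumrN; apply: sumr_ge0 => k.
  by rewrite andbT oppr_ge0 => /andP[/term/andP[]].
have lo' : - (8 / j%:R) <= S.
  apply: le_trans lo; rewrite lerN2 ler_pM2l //.
  under eq_bigr do rewrite -opprB.
  rewrite sumrN telescope_sumr // opprB.
  by rewrite add1n lerBlDr ler_wpDr ?invr_ge0 // lef_pV2 ?posrE // ler_nat.
by rewrite ler_norml zE; apply/andP; split; lra.
Qed.

Lemma sum_lt_indicator_le (R : numDomainType) (n M : nat) :
  \sum_(k < n) (k < M)%N%:R <= M%:R :> R.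
Proof.
rewrite -natr_sum ler_nat; apply: leq_trans (geq_minr n M).
elim: n => [|n IHn]; first by rewrite big_ord0.
by rewrite big_ord_recr /=; move: (\sum_(_ < n) _)%N IHn => c; lia.
Qed.

(** Abel's theorem with explicit error. Under the weights [(1 - z) z^m], the ranges [m < M],
    [M <= m <= n] and [n < m] account for the three summands; nothing but boundedness is known
    beyond [n]. *)
Lemma horner_abel_bound (R : realFieldType) (p : {poly R}) (z l e : R)
    (M n : nat) :
  (forall m, 0 <= p`_m <= 3) -> 0 <= l <= 3 -> 0 <= z < 1 -> 0 <= e ->
  (forall m, (M <= m <= n)%N -> `|p`_m - l| <= e) ->
  `|(1 - z) * p.[z] - l| <= 3 * M%:R * (1 - z) + e + 3 * z ^+ n.
Proof.
move=> p03 /andP[l_ge0 l_le3] /andP[z_ge0 z_lt1] e_ge0 p_near.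
pose S := (n.+1 + size p)%N.
have geo s : (1 - z) * \sum_(i < s) z ^+ i = 1 - z ^+ s.
  by rewrite -[1 - z]opprB mulNr -subrX1 opprB.
have zX i : 0 <= z ^+ i by rewrite exprn_ge0.
have -> : (1 - z) * p.[z] - l =
    (1 - z) * \sum_(m < S) (p`_m - l) * z ^+ m - l * z ^+ S.
  rewrite (@horner_coef_wide _ S) ?leq_addl //.
  under [in RHS]eq_bigr do rewrite mulrBl.
  by rewrite sumrB -mulr_sumr mulrBr mulrCA geo; ring.
have bound m : `|p`_m - l| <= 3 * (m < M)%N%:R + e + 3 * (n < m)%N%:R.
  have /andP[pm0 pm3] := p03 m.
  have pl3 : `|p`_m - l| <= 3 by rewrite ler_norml; apply/andP; split; lra.
  case: (ltnP m M) => [_|leMm] /=; first by have := ler0n R (n < m); lra.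
  case: (ltnP n m) => [_|lemn] /=; first by lra.
  by have := p_near m; rewrite leMm lemn => /(_ isT); lra.
have le1 : (1 - z) * `|\sum_(m < S) (p`_m - l) * z ^+ m| <=
    3 * M%:R * (1 - z) + e * (1 - z ^+ S) + 3 * (z ^+ n.+1 - z ^+ S).
  apply: (@le_trans _ _ ((1 - z) * \sum_(m < S)
      (3 * ((m < M)%N%:R * z ^+ m) + e * z ^+ m +
        3 * ((n < m)%N%:R * z ^+ m)))).
    apply: ler_wpM2l; first by lra.
    apply: le_trans (ler_norm_sum _ _ _) _; apply: ler_sum => m _.
    by rewrite normrM (ger0_norm (zX m)) !mulrA -!mulrDl ler_wpM2r.
  rewrite !big_split /= -!mulr_sumr [leLHS]mulrDr [X in X + _ <= _]mulrDr.
  rewrite lerD // ?lerD //.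
  - rewrite mulrCA -[leRHS]mulrA ler_pM2l // mulrC; apply: ler_wpM2r;
    first by lra.
    apply: (@le_trans _ _ (\sum_(m < S) (m < M)%N%:R)).
      by apply: ler_sum => m _; rewrite ler_piMr // exprn_ile1 // ltW.
    exact: sum_lt_indicator_le.
  - by rewrite mulrCA geo.
  - rewrite mulrCA ler_pM2l // /S big_split_ord /= big1 ?add0r => [|i _].
      under eq_bigr do rewrite ltn_addr // mul1r exprD.
      by rewrite -mulr_sumr mulrCA geo mulrBr mulr1 -exprD.
    by rewrite ltnNge -ltnS ltn_ord mul0r.
apply: le_trans (ler_normB _ _) _; rewrite normrM gtr0_norm ?subr_gt0 //.
rewrite (ger0_norm (mulr_ge0 l_ge0 (zX S))).
have zS1 : z ^+ S <= 1 by rewrite exprn_ile1 // ltW.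
have zSn : z ^+ n.+1 <= z ^+ n by rewrite exprS ler_piMl // ltW.
have lz : l * z ^+ S <= 3 * z ^+ S by rewrite ler_wpM2r.
have ez : e * (1 - z ^+ S) <= e by rewrite ler_piMr // gerBl.
by lra.
Qed.

Lemma pmf_coef_lim (R : realType) :
  (fun m => pmf_coef R m m) @ \oo --> expR (- euler_gamma R).
Proof.
have cvg_c := @pmf_coef_cvg R; set l := limn (fun m => pmf_coef R m m) in cvg_c.
have l_ge0 : 0 <= l.
  by apply: limr_ge => //; apply: nearW => m; exact: pmf_coef_ge0.
have l_le3 : l <= 3.
  by apply: limr_le => //; apply: nearW => m; exact: pmf_coef_le3.
(* With [z i] below, [z i] tends to 1 while [n i * (1 - z i) = i + 1] tends to infinity, so
   [z i ^+ n i] and the truncation error of the logarithm series both vanish. *)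
pose n i := (i.+1 ^ 2)%N.
pose z i : R := 1 - i.+1%:R^-1.
pose W i := (partprod (fun k => k%:R^-1 : R) (n i)).[z i].
have n_gt0 i : (0 < n i)%N by rewrite expn_gt0.
have inv_gt0 i : 0 < i.+1%:R^-1 :> R by rewrite invr_gt0.
have z01 i : 0 <= z i < 1.
  by rewrite /z subr_ge0 invf_le1 // ler1n /= ltrBlDr ltrDl inv_gt0.
have nE i : (n i)%:R = i.+1%:R ^+ 2 :> R by rewrite natrX.
have zB i : 1 - z i = i.+1%:R^-1 by rewrite /z opprB addrC subrK.
have harm0 := @cvg_harmonic R.
have vl : (fun i => (1 - z i) * W i) @ \oo --> l.
  apply/cvgrPdist_le => e e_gt0.
  have e2_gt0 : 0 < e / 2 by rewrite divr_gt0.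
  have /cvgrPdist_le/(_ _ e2_gt0)[M _ cM] := cvg_c.
  have K_gt0 : 0 < 3 * M%:R + 3 :> R by rewrite ltr_wpDl // mulr_ge0.
  have : 0 < e / 2 / (3 * M%:R + 3) by rewrite divr_gt0.
  move/cvgrPdist_le: harm0 => /[apply]; apply: filterS => i.
  rewrite sub0r normrN ger0_norm /= ?invr_ge0 // ler_pdivlMr // => small.
  rewrite distrC.
  have := @horner_abel_bound R
    (partprod (fun k => k%:R^-1) (n i)) (z i) l (e / 2) M (n i).
  move/(_ _ _ (z01 i) (ltW e2_gt0) _)/le_trans; apply.
  - by move=> m; rewrite pmf_coef_ge0 pmf_coef_le3.
  - by rewrite l_ge0.
  - move=> m /andP[leMm lemn]; rewrite distrC.
    by rewrite -/(pmf_coef R (n i) m) pmf_coef_stable //; exact: cM.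
  (* [n z^n] is at most [1 + z + ... + z^(n-1) <= 1/(1 - z)]. *)
  have zn : z i ^+ n i <= i.+1%:R^-1.
    have /andP[z_ge0 z_lt1] := z01 i.
    have sum_ge : (n i)%:R * z i ^+ n i <= \sum_(k < n i) z i ^+ k.
      rewrite -[X in X%:R]card_ord mulr_natl -sumr_const; apply: ler_sum => k _.
      by apply: ler_wiXn2l => //; [exact: ltW | exact: ltnW].
    have := ler_wpM2l (ltW (inv_gt0 i)) sum_ge.
    rewrite -{2}zB -[1 - z i]opprB mulNr -subrX1 opprB nE mulrA expr2 mulKf //.
    move=> le1; rewrite -(ler_pM2l (ltr0Sn R i)) mulfV //.
    by apply: le_trans le1 _; rewrite gerBl exprn_ge0.
  rewrite zB; move: zn small.
  move: (i.+1%:R^-1) (z i ^+ n i) M%:R => u w M' zn small. lra.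
have lnv : (fun i => ln ((1 - z i) * W i)) @ \oo --> - euler_gamma R.
  have gam : (fun i => series harmonic (n i) - ln (n i)%:R) @ \oo -->
    euler_gamma R.
    apply/cvgrPdist_le => e e_gt0.
    have /cvgrPdist_le/(_ _ e_gt0)[N _ gN] := @euler_gamma_cvg R.
    exists N => // i /= leNi; apply: gN => /=; apply: leq_trans leNi _.
    by rewrite /n -mulnn; nia.
  rewrite -[- _]add0r (_ : (fun i => _) =
      (fun i => ln ((1 - z i) * W i) + (series harmonic (n i) - ln (n i)%:R)) -
      (fun i => series harmonic (n i) - ln (n i)%:R)); last first.
    by apply/funext => i; rewrite fctE addrK.
  apply: cvgB gam; apply/norm_cvg0P.
  have up0 : (fun i => 10 * harmonic i : R) @ \oo --> (0 : R).
    by rewrite -[0](mulr0 (10 : R)); apply: cvgMr.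
  apply: squeeze_cvgr _ up0; last exact: (cvg_cst 0).
  apply: nearW => i; rewrite normr_ge0 /=.
  have /andP[z_ge0 z_lt1] := z01 i.
  have z01' : 0 <= z i <= 1 by rewrite z_ge0 ltW.
  have [W_gt0 _] := pmf_horner_ln (n_gt0 i) z01'.
  have /andP[lo hi] := ln1B_series_bounds (n i) (z01 i).
  have bnd := pmf_horner_ln_bound (n_gt0 i) (ltn0Sn i) (erefl (z i)).
  rewrite lnM ?posrE ?subr_gt0 //.
  (* Splitting the harmonic sum pairs [ln (1 - z)] with its truncated series and [ln W - ln n] with
     the sum of [pmf_horner_ln_bound]. The errors [1/(i+1)] and [9/(i+1)] give the constant 10. *)
  have hE : series harmonic (n i) = \sum_(k < n i) k.+1%:R^-1 * z i ^+ k.+1 +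
      \sum_(k < n i) (1 - z i ^+ k.+1) / k.+1%:R.
    rewrite -big_split /series /= big_mkord; apply: eq_bigr => k _.
    by rewrite mulrC -mulrDl addrC subrK mul1r.
  have lo' : - i.+1%:R^-1 <= ln (1 - z i) +
    \sum_(k < n i) k.+1%:R^-1 * z i ^+ k.+1.
    apply: le_trans lo; rewrite lerN2 zB.
    rewrite lef_pV2 ?posrE ?mulr_gt0 // ler_pdivlMr //.
    by rewrite -[(n i).+1%:R]natr1 nE expr2 lerDl.
  rewrite hE; move: bnd lo' hi; rewrite !ler_norml => /andP[].
  move: (ln _) (ln _) (ln _) (\sum_(k < _) _) (\sum_(k < _) _) i.+1%:R^-1.
  by move=> a b c s t u b1 b2 lo' hi; apply/andP; split; lra.
have : (fun i => expR (ln ((1 - z i) * W i))) @ \oo --> expR (- euler_gamma R).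
  by apply: (continuous_cvg _ _ lnv); exact: continuous_expR.
rewrite (_ : (fun i => expR _) = (fun i => (1 - z i) * W i)); last first.
  apply/funext => i; rewrite lnK // posrE.
  have /andP[z_ge0 z_lt1] := z01 i.
  have z01' : 0 <= z i <= 1 by rewrite z_ge0 ltW.
  have [W_gt0 _] := pmf_horner_ln (n_gt0 i) z01'.
  by rewrite mulr_gt0 // subr_gt0.
by move=> /(cvg_unique (@Rhausdorff R) vl) <-.
Qed.

(** * The Dickman function *)

Lemma dickman_MVT (R : realType) (rho : R -> R) (a b : R) :
  is_dickman rho -> 1 <= a -> a <= b ->
  exists2 c, a <= c <= b & rho a - rho b = rho (c - 1) / c * (b - a).
Proof.
move=> [rho_cont _ rho_eq] a_ge1; rewrite le_eqVlt => /predU1P[<-|ltab].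
  by exists a; rewrite ?lexx // !subrr mulr0.
have [||c] := @MVT _ rho (fun x => - (rho (x - 1) / x)) a b ltab.
- move=> x; rewrite in_itv /= => /andP[ltax _].
  have [d_x E] := rho_eq x (le_lt_trans a_ge1 ltax).
  have x_neq0 : x != 0 by rewrite lt0r_neq0 //; lra.
  apply: DeriveDef => //; rewrite -derive1E; apply: (mulfI x_neq0).
  by rewrite mulrN mulrCA mulfV // mulr1; lra.
- apply: continuous_subspaceW rho_cont => x /=; rewrite !in_itv /= andbT.
  by move=> /andP[]; lra.
rewrite in_itv /= => /andP[ltac ltcb] E; exists c; first by rewrite !ltW.
by rewrite -[LHS]opprB E mulNr opprK.
Qed.

(** A bound for [rho] is also a Lipschitz constant: beyond 1 the derivative is [- rho (c - 1) / c]
    with [c >= 1], and on [0, 1] [rho] is constant. *)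
Lemma dickman_bound_lipschitz (R : realType) (rho : R -> R) (B : R) :
  is_dickman rho -> 0 <= B -> exists K, [/\ 0 <= K,
    forall a, 0 <= a <= B -> `|rho a| <= K &
    forall a b, 0 <= a -> a <= b -> b <= B ->
      `|rho a - rho b| <= K * (b - a)].
Proof.
move=> rhoD B_ge0; have [rho_cont rho1 _] := rhoD.
have cB : {within `[0, B], continuous rho}.
  apply: continuous_subspaceW rho_cont => x /=; rewrite !in_itv /= andbT.
  by move=> /andP[].
have [p _ rho_le] := EVT_max B_ge0 cB.
have [q _ rho_ge] := EVT_min B_ge0 cB.
have bound a : 0 <= a <= B -> `|rho a| <= `|rho p| + `|rho q|.
  move=> aB; have := rho_le a; have := rho_ge a; rewrite in_itv aB /=.
  move=> /(_ isT) ge /(_ isT) le.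
  have := ler_norm (rho p); have := ler_norm (- rho q); rewrite normrN.
  have := normr_ge0 (rho p); have := normr_ge0 (rho q).
  by rewrite ler_norml => ? ? ? ?; apply/andP; split; lra.
have K_ge0 : 0 <= `|rho p| + `|rho q| by rewrite addr_ge0.
exists (`|rho p| + `|rho q|); split => //.
move: (_ + _) K_ge0 bound => K K_ge0 bound.
have lip a b : 1 <= a -> a <= b -> b <= B -> `|rho a - rho b| <= K * (b - a).
  move=> a_ge1 leab lebB; have [c /andP[leac lecb] ->] :=
    dickman_MVT rhoD a_ge1 leab.
  have c_ge1 : 1 <= c by lra.
  rewrite normrM (ger0_norm (_ : 0 <= b - a)) ?subr_ge0 // ler_wpM2r
    ?subr_ge0 //.
  rewrite normrM normfV (ger0_norm (_ : 0 <= c)); last by lra.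
  rewrite ler_pdivrMr; last by lra.
  apply: le_trans (bound (c - 1) _) _; first by apply/andP; split; lra.
  by rewrite ler_peMr.
move=> a b a_ge0 leab lebB.
have [a_ge1|a_lt1] := leP 1 a; first exact: lip.
have rho_a : rho a = rho 1 by rewrite !rho1 ?ler01 ?lexx // a_ge0 ltW.
have [b_ge1|b_lt1] := leP 1 b.
  rewrite rho_a; apply: le_trans (lip 1 b _ _ _) _ => //.
  by rewrite ler_wpM2l // lerD2l lerN2 ltW.
have -> : rho b = 1 by rewrite rho1 // (le_trans a_ge0 leab) ltW.
by rewrite rho_a rho1 ?ler01 ?lexx // subrr normr0 mulr_ge0 // subr_ge0.
Qed.

(** With [a = m/(k+1)] and [b = m/k], the increment is [rho (c - 1) * (b - a) / c] for some [c] in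
    [a, b]. As [b - a = a/k = b/(k+1)], the ratio [(b - a)/c] lies between [1/(k+1)] and [1/k]; and
    [y] and [c - 1] both lie in [a - 1, b - 1], of length at most [B/k]. *)
Lemma dickman_increment (R : realType) (rho : R -> R) (B K : R) (k m : nat) :
  is_dickman rho ->
  (forall a, 0 <= a <= B -> `|rho a| <= K) ->
  (forall a b, 0 <= a -> a <= b -> b <= B ->
      `|rho a - rho b| <= K * (b - a)) ->
  (0 < k)%N -> (k < m)%N -> m%:R <= B * k%:R ->
  `|k%:R^-1 * rho ((m - k.+1)%:R / k%:R) -
    (rho (m%:R / k.+1%:R) - rho (m%:R / k%:R))| <= K * (B + 1) / k%:R ^+ 2.
Proof.
move=> rhoD bound lip k_gt0 ltkm leB.
have k0 : 0 < k%:R :> R by rewrite ltr0n.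
have m1k : k%:R + 1 <= m%:R :> R by rewrite natr1 ler_nat.
have k10 : 0 < k.+1%:R :> R by [].
have y_eq : (m - k.+1)%:R / k%:R = (m%:R - 1) / k%:R - 1 :> R.
  by rewrite natrB // -natr1; field; rewrite lt0r_neq0.
set y := _ / k%:R in y_eq *.
set a := m%:R / k.+1%:R; set b := m%:R / k%:R.
have a_ge1 : 1 <= a by rewrite ler_pdivlMr // mul1r ler_nat.
have ba : b - a = m%:R / (k%:R * (k%:R + 1)).
  by rewrite /a /b -natr1; field; rewrite !lt0r_neq0; lra.
have leab : a <= b.
  by rewrite -subr_ge0 ba divr_ge0 // mulr_ge0 // addr_ge0.
have bB : b <= B by rewrite ler_pdivrMr.
have [c /andP[leac lecb] ->] := dickman_MVT rhoD a_ge1 leab.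
have c0 : 0 < c by lra.
have ay : a - 1 <= y.
  rewrite y_eq lerD2r /a ler_pdivrMr // mulrAC ler_pdivlMr // -natr1; nra.
have yb : y <= b - 1 by rewrite y_eq lerD2r /b ler_pM2r ?invr_gt0 //; lra.
have y0 : 0 <= y by lra.
have bak : b - a <= B / k%:R.
  have kk_gt0 : 0 < k%:R * (k%:R + 1) :> R by rewrite mulr_gt0; lra.
  rewrite ba ler_pdivrMr //.
  rewrite mulrA divfK ?lt0r_neq0 //.
  apply: le_trans leB _; rewrite ler_wpM2l; lra.
have cB : 0 <= c - 1 <= B by apply/andP; split; lra.
have K_ge0 : 0 <= K by apply: le_trans (bound _ cB).
have near_y : `|rho y - rho (c - 1)| <= K * (B / k%:R).
  have [leyc|ltcy] := leP y (c - 1).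
    apply: le_trans (lip _ _ y0 leyc _) _; first by lra.
    by rewrite ler_wpM2l //; lra.
  rewrite distrC; apply: le_trans (lip _ _ _ (ltW ltcy) _) _; try lra.
  by rewrite ler_wpM2l //; lra.
rewrite [rho (c - 1) / c * _]mulrAC -mulrA.
set th := (b - a) / c.
have th_le : th <= k%:R^-1.
  rewrite ler_pdivrMr //; apply: le_trans (_ : k%:R^-1 * a <= _).
    rewrite le_eqVlt; apply/orP; left; apply/eqP.
    by rewrite ba /a -natr1; field; rewrite !lt0r_neq0; lra.
  by rewrite ler_pM2l ?invr_gt0.
have th_ge : k%:R^-1 - k%:R ^- 2 <= th.
  apply: (@le_trans _ _ (k%:R + 1)^-1).
    rewrite -subr_ge0 (_ : _ - _ = (k%:R ^+ 2 * (k%:R + 1))^-1); last first.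
      by field; rewrite !lt0r_neq0; lra.
    by rewrite invr_ge0 mulr_ge0 ?exprn_ge0 //; lra.
  rewrite ler_pdivlMr //; apply: (@le_trans _ _ ((k%:R + 1)^-1 * b)).
    by rewrite ler_pM2l // invr_gt0; lra.
  rewrite le_eqVlt; apply/orP; left; apply/eqP.
  by rewrite ba /b; field; rewrite !lt0r_neq0; lra.
have -> : k%:R^-1 * rho y - rho (c - 1) * th =
    k%:R^-1 * (rho y - rho (c - 1)) + rho (c - 1) * (k%:R^-1 - th) by ring.
apply: le_trans (ler_normD _ _) _; rewrite !normrM.
have -> : K * (B + 1) / k%:R ^+ 2 = k%:R^-1 * (K * (B / k%:R)) + K * k%:R ^- 2.
  by field; rewrite lt0r_neq0.
rewrite lerD //; first by rewrite gtr0_norm ?invr_gt0 // ler_wpM2l // invr_ge0.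
rewrite ler_pM // ?bound // ger0_norm ?subr_ge0 //.
by move: th_ge; rewrite lerBlDr lerBlDl addrC.
Qed.

Lemma pmf_coef_dickman (R : realType) (rho : R -> R) (N : nat) (e : R) :
  is_dickman rho -> 0 < e ->
  exists M : nat, forall n m, (0 < n)%N -> (M <= m)%N -> (m <= N.+1 * n)%N ->
    `|pmf_coef R n m - expR (- euler_gamma R) * rho (m%:R / n%:R)| <= e.
Proof.
move=> rhoD; have [_ rho1 _] := rhoD.
set l := expR _; have lim_c : (fun m => pmf_coef R m m) @ \oo --> l.
  exact: pmf_coef_lim.
have l_ge0 : 0 <= l by exact: expR_ge0.
have l_le3 : l <= 3.
  rewrite -(cvg_lim (@Rhausdorff R) lim_c); apply: limr_le;
    first exact: cvgP lim_c.
  by apply: nearW => m; exact: pmf_coef_le3.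
have base d : 0 < d -> exists M : nat, forall n m, (0 < n)%N -> (M <= m)%N ->
    (m <= n)%N -> `|pmf_coef R n m - l * rho (m%:R / n%:R)| <= d.
  move=> d_gt0; have /cvgrPdist_le/(_ _ d_gt0)[M _ cM] := lim_c.
  exists M => n m n_gt0 leMm lemn; rewrite pmf_coef_stable // rho1.
    by rewrite mulr1 distrC; exact: cM.
  by rewrite divr_ge0 //= ler_pdivrMr ?ltr0n // mul1r ler_nat.
elim: N e => [|N IHN] e e_gt0.
  by have [M cM] := base e e_gt0; exists M => n m; rewrite mul1n; exact: cM.
pose B : R := N.+2%:R.
have B_gt0 : 0 < B by [].
have [K [K_ge0 bound lip]] := dickman_bound_lipschitz rhoD (ltW B_gt0).
have e4_gt0 : 0 < e / 4 by rewrite divr_gt0.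
have [M1 cM1] := base _ e4_gt0.
(* The sum over [n <= k < m] has at most [B n] terms of weight at most [1/n], so an error [e'] in
   each adds up to [e/4]. *)
pose e' := e / 4 / B.
have e'_gt0 : 0 < e' by rewrite divr_gt0.
have [M2 cM2] := IHN _ e'_gt0.
pose C1 := 3 + 3 * K; pose C2 := 3 * (K * (B + 1)).
have C1_ge0 : 0 <= C1 by rewrite addr_ge0 // mulr_ge0.
have C2_ge0 : 0 <= C2 by rewrite !mulr_ge0 // addr_ge0.
(* [D / n] collects the increment errors and the at most [M2] indices [k] with [m - k - 1 < M2],
   where the induction hypothesis is silent and the trivial bound [C1] is used. [M3] makes it at
   most [e/4], since [n >= m/B]. *)
pose D := B * C2 + C1 * M2%:R.
have D_ge0 : 0 <= D by rewrite addr_ge0 // mulr_ge0.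
have [M3 leM3] : exists M3 : nat, B * D / (e / 4) <= M3%:R.
  have X_ge0 : 0 <= B * D / (e / 4) by rewrite divr_ge0 ?(ltW e4_gt0) ?mulr_ge0.
  by exists (Num.bound (B * D / (e / 4))); rewrite ltW // archi_boundP.
exists (maxn M1 M3) => n m n_gt0; rewrite geq_max => /andP[leM1m leM3m] lem.
have [lemn|ltnm] := leqP m n.
  by apply: le_trans (cM1 _ _ n_gt0 leM1m lemn) _; lra.
have n0 : 0 < n%:R :> R by rewrite ltr0n.
have lemB : m%:R <= B * n%:R by rewrite -natrM ler_nat.
have cm_l : `|pmf_coef R m m - l| <= e / 4.
  have m_gt0 : (0 < m)%N by apply: leq_ltn_trans ltnm.
  have := cM1 m m m_gt0 leM1m (leqnn m).
  by rewrite divff ?pnatr_eq0 -?lt0n // rho1 ?mulr1 // ler01 lexx.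
have rho_tele : rho (m%:R / n%:R) = 1 - \sum_(n <= k < m)
    (rho (m%:R / k.+1%:R) - rho (m%:R / k%:R)).
  rewrite (telescope_sumr (fun k => rho (m%:R / k%:R)) (ltnW ltnm)).
  rewrite divff ?pnatr_eq0 -?lt0n ?(leq_ltn_trans _ ltnm) //.
  by rewrite [rho 1]rho1 ?ler01 ?lexx // opprB subrKC.
rewrite (pmf_coef_telescope R (ltnW ltnm)) rho_tele.
set S1 := \sum_(_ <= _ < _) _; set S2 := \sum_(_ <= _ < _) (_ - _).
have -> : pmf_coef R m m - S1 - l * (1 - S2) =
    (pmf_coef R m m - l) - (S1 - l * S2) by ring.
apply: le_trans (ler_normB _ _) _.
suff S_le : `|S1 - l * S2| <= B * e' + D / n%:R.
  have E1 : B * e' = e / 4 by rewrite /e' mulrC divfK // lt0r_neq0.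
  have E2 : D / n%:R <= e / 4.
    rewrite ler_pdivrMr // -(ler_pM2l B_gt0) mulrCA.
    rewrite -ler_pdivrMl //; apply: le_trans lemB; rewrite mulrC.
    by apply: le_trans leM3 _; rewrite ler_nat.
  by move: S_le; rewrite E1; lra.
rewrite /S1 /S2 mulr_sumr -sumrB.
have sum1 : \sum_(n <= k < m) (1 : R) <= B * n%:R.
  rewrite sumr_const_nat; apply: le_trans lemB.
  by rewrite ler_nat leq_subr.
have term k : (n <= k < m)%N ->
    `|k%:R^-1 * pmf_coef R k (m - k.+1)
       - l * (rho (m%:R / k.+1%:R) - rho (m%:R / k%:R))| <=
    n%:R^-1 * (e' * 1 + C2 / n%:R * 1 + C1 * (m - k.+1 < M2)%N%:R).
  move=> /andP[lenk ltkm]; have k_gt0 : (0 < k)%N by apply: leq_trans lenk.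
  have k0 : 0 < k%:R :> R by rewrite ltr0n.
  have k_inv : k%:R^-1 <= n%:R^-1 :> R by rewrite lef_pV2 ?posrE // ler_nat.
  have lemk : m%:R <= B * k%:R.
    by apply: le_trans lemB _; rewrite ler_pM2l // ler_nat.
  have incr := dickman_increment rhoD bound lip k_gt0 ltkm lemk.
  set y := _ / k%:R in incr.
  have y_in : 0 <= y <= B.
    rewrite divr_ge0 //= ler_pdivrMr //; apply: le_trans lemk.
    by rewrite ler_nat leq_subr.
  have near_c : `|pmf_coef R k (m - k.+1) - l * rho y| <=
      e' + C1 * (m - k.+1 < M2)%N%:R.
    case: ltnP => [_|leM2] /=.
      rewrite mulr1; apply: le_trans (_ : C1 <= _); last by rewrite lerDr ltW.
      apply: le_trans (ler_normB _ _) _; rewrite lerD //.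
        by rewrite ger0_norm ?pmf_coef_ge0 ?pmf_coef_le3.
      by rewrite normrM ler_pM ?bound // ger0_norm.
    rewrite mulr0 addr0; apply: cM2 => //; rewrite leq_subLR (leq_trans lem) //.
    by rewrite (leq_trans (leq_mul (leqnn _) lenk)) // mulSn leq_add2r.
  set d := rho _ - rho _ in incr *.
  have -> : k%:R^-1 * pmf_coef R k (m - k.+1) - l * d =
     k%:R^-1 * (pmf_coef R k (m - k.+1) - l * rho y) +
       l * (k%:R^-1 * rho y - d).
    by ring.
  apply: le_trans (ler_normD _ _) _.
  rewrite !normrM (gtr0_norm (_ : 0 < k%:R^-1)) ?invr_gt0 // (ger0_norm l_ge0).
  have h1 : k%:R^-1 * `|pmf_coef R k (m - k.+1) - l * rho y| <=
      n%:R^-1 * (e' + C1 * (m - k.+1 < M2)%N%:R).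
    by rewrite ler_pM // invr_ge0.
  have h2 : l * `|k%:R^-1 * rho y - d| <= n%:R^-1 * (C2 / n%:R).
    apply: le_trans (_ : 3 * (K * (B + 1) / k%:R ^+ 2) <= _).
      by rewrite ler_pM.
    rewrite mulrA -/C2 mulrCA ler_wpM2l // -invfM lef_pV2 ?posrE ?mulr_gt0
      ?exprn_gt0 //.
    by rewrite expr2 ler_pM // ler_nat.
  by apply: le_trans (lerD h1 h2) _; rewrite !mulr1 -mulrDr addrAC.
apply: le_trans (ler_norm_sum _ _ _) _.
apply: le_trans (_ : \sum_(n <= k < m)
  n%:R^-1 * (e' * 1 + C2 / n%:R * 1 + C1 * (m - k.+1 < M2)%N%:R) <= _).
  exact: ler_sum_nat.
rewrite -mulr_sumr !big_split /= -!mulr_sumr.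
have ind : \sum_(n <= k < m) (m - k.+1 < M2)%N%:R <= M2%:R :> R.
  apply: le_trans (sum_lt_indicator_le R m M2).
  rewrite -(big_mkord xpredT (fun k => (k < M2)%N%:R)) [leRHS]big_nat_rev /=.
  rewrite (@big_cat_nat _ _ _ n 0 m) //=; last exact: ltnW.
  by rewrite lerDr sumr_ge0.
rewrite ler_pdivrMl // mulrDr.
have -> : n%:R * (B * e') + n%:R * (D / n%:R) =
  e' * (B * n%:R) + C2 / n%:R * (B * n%:R) + C1 * M2%:R.
  by rewrite /D; field; rewrite lt0r_neq0.
by apply: lerD; [apply: lerD|]; apply: ler_wpM2l => //;
  [exact: ltW | exact: divr_ge0].
Qed.

(** * The law of [T_n] *)

(** The law of [T_n] by conditioning on the last variable, see [pmf_law]; arguments in [int] keep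
    the subtraction from truncating. *)
Fixpoint pmf (R : realFieldType) (n : nat) (z : int) : R :=
  if n is k.+1
  then (1 - k.+1%:R^-1) * pmf R k z + k.+1%:R^-1 * pmf R k (z - k.+1%:Z)
  else (z == 0)%:R.

Lemma pmfS (R : realFieldType) (n : nat) (z : int) :
  pmf R n.+1 z =
  (1 - n.+1%:R^-1) * pmf R n z + n.+1%:R^-1 * pmf R n (z - n.+1%:Z).
Proof. by []. Qed.

(** In the generating function of [T_n] the factor of index 1 is [X], and the others are [(k-1)/k]
    times [1 + X^k/(k-1)]; the constants multiply to [1/n], which leaves [X W_n / n]. *)
Lemma pmfE (R : realFieldType) (n : nat) (z : int) : (0 < n)%N ->
  n%:R * pmf R n z = if z is Posz m.+1 then pmf_coef R n m else 0.
Proof.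
case: n => // n _; elim: n z => [|n IHn] z.
  rewrite /= mul1r invr1 subrr mul0r add0r mul1r.
  rewrite /pmf_coef /partprod; case: z => [[|m]|m] //.
  rewrite big_ord1 invr0 scale0r addr0 coef1.
  by congr (_%:R); congr nat_of_bool; apply/eqP/eqP; lia.
have -> : n.+2%:R * pmf R n.+2 z =
    n.+1%:R * pmf R n.+1 z + n.+1%:R^-1 * (n.+1%:R * pmf R n.+1 (z - n.+2%:Z)).
  rewrite mulKf ?pnatr_eq0 // pmfS.
  move: (pmf R n.+1 z) (pmf R n.+1 (z - n.+2%:Z)) => a b.
  have n_ge0 : 0 <= n%:R :> R by [].
  by field; apply: lt0r_neq0; lra.
rewrite !IHn; case: z => [[|m]|m].
- by rewrite add0r mulr0.
- rewrite [RHS]pmf_coefS; congr (_ + _); case: ltnP => [ltnm|lemn].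
    by rewrite (_ : Posz m.+1 - _ = Posz (m - n.+2).+1); last by lia.
  case E : (Posz m.+1 - n.+2%:Z) => [[|q]|q]; rewrite ?mulr0 //; lia.
case E : (Negz m - n.+2%:Z) => [[|q]|q]; rewrite ?mulr0 ?addr0 //; lia.
Qed.

(** The values [a] and [b] exhaust the mass of [X], so the rest of [A] is contained in a null
    set. *)
Lemma probability_split_values (d : measure_display) (Omega : measurableType d)
    (R : realType) (P : probability Omega R) (X : {RV P >-> R}) (a b : R)
    (A : set Omega) :
  measurable A -> a != b ->
  (P (X @^-1` [set a]) + P (X @^-1` [set b]) = 1)%E ->
  (P A = P (A `&` X @^-1` [set a]) + P (A `&` X @^-1` [set b]))%E.
Proof.
move=> mA neq_ab.
have mX c : measurable (X @^-1` [set c]) by apply: measurable_funPTI.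
have dis : X @^-1` [set a] `&` X @^-1` [set b] = set0.
  apply/seteqP; split=> w //= [Xa Xb]; move: neq_ab.
  by rewrite -Xa -Xb eqxx.
move: (mX a) (mX b) dis; set U := X @^-1` _; set V := X @^-1` _.
move=> mU mV dis; rewrite -measureU // => PUV1.
have PN0 : P (~` (U `|` V)) = 0%E.
  by rewrite probability_setC ?PUV1 ?subee //; exact: measurableU.
have mN : measurable (~` (U `|` V)) by apply: measurableC; exact: measurableU.
rewrite -[in LHS](setIT A) -(setUv (U `|` V)) setIUr measureU0 //.
- rewrite setIUr measureU //; try exact: measurableI.
  by rewrite setIACA dis setI0.
- by apply: measurableI => //; exact: measurableU.
- exact: measurableI.
- apply: (subset_measure0 _ _ _ PN0) => //; exact: measurableI.
Qed.

Lemma pmf_law (R : realType) (d : measure_display)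
    (Omega : measurableType d) (P : probability Omega R)
    (Z : nat -> {RV P >-> R}) (n : nat) (z : int) :
  independent_RVs [set k : nat | (1 <= k)%N] Z ->
  (forall k : nat, (1 <= k)%N ->
      P (Z k @^-1` [set (1 : R)]) = (k%:R^-1)%:E) ->
  (forall k : nat, (1 <= k)%N ->
      P (Z k @^-1` [set (0 : R)]) = (1 - k%:R^-1)%:E) ->
  P ((fun w => \sum_(1 <= k < n.+1) k%:R * Z k w) @^-1` [set z%:~R]) =
  (pmf R n z)%:E.
Proof.
move=> Z_indep Z_eq1 Z_eq0.
pose S i w : R := \sum_(1 <= k < i.+1) k%:R * Z k w.
pose F (B : nat -> set R) i :=
  \bigcap_(k in [set k | (i < k <= n)%N]) (Z k @^-1` B k).
have mS i (y : R) : measurable (S i @^-1` [set y]).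
  rewrite -[X in measurable X]setTI.
  have : measurable_fun setT (S i).
    by apply: measurable_sum => k; apply: measurable_realfun.measurable_funM.
  by move=> /(_ measurableT [set y] (measurable_set1 _)).
have mF B i : (forall k, measurable (B k)) -> measurable (F B i).
  move=> mB; apply: bigcap_measurableType => k _; apply: measurable_funPTI.
  exact: mB.
(* Carrying arbitrary conditions on the variables not yet summed lets the induction use independence
   only once, for [i = 0]; each step turns the condition [Z i.+1 = c] into one more set of the
   family. *)
suff gen i B (y : int) : (i <= n)%N -> (forall k, measurable (B k)) ->
    (P (S i @^-1` [set y%:~R] `&` F B i) =
    (pmf R i y)%:E * \prod_(i.+1 <= k < n.+1) P (Z k @^-1` B k))%E.
  have := gen n (fun=> setT) z (leqnn n) (fun=> measurableT).
  rewrite [X in _ `&` X](_ : _ = setT) ?setIT; last first.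
    by apply/seteqP; split => // w _ k /=; lia.
  by rewrite big_geq // mule1.
elim: i B y => [|i IHi] B y lein mB.
  have PF : P (F B 0%N) = (\prod_(1 <= k < n.+1) P (Z k @^-1` B k))%E.
    pose J := [fset k in iota 1 n]%fset.
    have JE k : (k \in J) = (1 <= k <= n)%N by rewrite !inE /= mem_iota; lia.
    have JD : [set` J] `<=` [set k | (1 <= k)%N]
      by move=> k /=; rewrite JE => /andP[].
    rewrite (_ : F B 0%N = \bigcap_(k in [set` J]) Z k @^-1` B k); last first.
      by apply: eq_bigcapl; split => k /=; rewrite JE.
    rewrite (Z_indep J B JD (fun k _ => mB k)).
    apply: perm_big; apply: uniq_perm;
      [exact: fset_uniq|exact: iota_uniq|move=> k].
    by rewrite JE mem_index_iota ltnS.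
  have S0 w : S 0%N w = 0 by rewrite /S big_geq.
  rewrite /=; have [->|y_neq0] := eqVneq y 0.
    rewrite mul1e -PF; congr (P _); rewrite -[RHS]setTI; congr (_ `&` _).
    by apply/seteqP; split => w //= _; rewrite S0.
  rewrite mul0e [X in P X](_ : _ = set0) ?measure0 //.
  apply/seteqP; split => w //= [+ _]; rewrite S0 => /esym/eqP.
  by rewrite intr_eq0 (negbTE y_neq0).
pose B' c k := if k == i.+1 then [set c] else B k.
have mB' c k : measurable (B' c k).
  by rewrite /B'; case: ifP => _; [exact: measurable_set1 | exact: mB].
have prodE c : (\prod_(i.+1 <= k < n.+1) P (Z k @^-1` B' c k) =
    P (Z i.+1 @^-1` [set c]) * \prod_(i.+2 <= k < n.+1) P (Z k @^-1` B k))%E.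
  rewrite big_ltn // /B' eqxx; congr (_ * _)%E;
    apply: eq_big_nat => k /andP[ltik _].
  by rewrite (gtn_eqF ltik).
have setE (c : nat) : S i.+1 @^-1` [set y%:~R] `&` F B i.+1 `&`
      Z i.+1 @^-1` [set c%:R]
    = S i @^-1` [set (y - (i.+1 * c)%N%:Z)%:~R] `&` F (B' c%:R) i.
  have SE w : Z i.+1 w = c%:R ->
    (S i.+1 w = y%:~R) <-> (S i w = (y - (i.+1 * c)%N%:Z)%:~R).
    move=> Zc; rewrite /S big_nat_recr //= Zc rmorphB /= -natrM.
    by split => [<-|->]; rewrite ?addrK ?subrK.
  apply/seteqP; split => w /=.
    move=> [[Sy Fw] Zc]; split; first exact/SE.
    move=> k /= /andP[ltik lekn]; rewrite /B'; case: eqP => [->//|neq].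
    by apply: Fw => /=; lia.
  move=> [Sy Fw]; have Zc : Z i.+1 w = c%:R.
    have := Fw i.+1; rewrite /= /B' eqxx; apply; lia.
  split=> //; split; first exact/SE.
  move=> k /= /andP[ltik lekn]; have := Fw k; rewrite /= /B' (gtn_eqF ltik).
  by apply; lia.
rewrite (@probability_split_values _ _ _ _ (Z i.+1) 0 1).
- rewrite (setE 0%N) (setE 1%N) !IHi ?(ltnW lein) // !prodE.
  rewrite Z_eq1 // Z_eq0 // muln0 muln1 subr0.
  rewrite !muleA -muleDl //.
  + by rewrite -!EFinM -EFinD ![_ * (_ - _)]mulrC [in X in _ + X]mulrC.
  + by apply: prode_fin_num => k _; apply: fin_num_measure;
    apply: measurable_funPTI.
- by apply: measurableI; [exact: mS | exact: mF].
- by rewrite eq_sym oner_neq0.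
- by rewrite Z_eq1 // Z_eq0 // -EFinD subrK.
Qed.

(** * The limit along a sequence of integers *)

Theorem theorem2p1 (R : realType) (d : measure_display)
    (Omega : measurableType d) (P : probability Omega R)
    (Z : nat -> {RV P >-> R})
    (Z_indep : independent_RVs [set k : nat | (1 <= k)%N] Z)
    (Z_eq1 : forall k : nat, (1 <= k)%N ->
      P (Z k @^-1` [set (1 : R)]) = (k%:R^-1)%:E)
    (Z_eq0 : forall k : nat, (1 <= k)%N ->
      P (Z k @^-1` [set (0 : R)]) = (1 - k%:R^-1)%:E)
    (T : nat -> Omega -> R)
    (T_def : forall (n : nat) (w : Omega),
      T n w = \sum_(1 <= k < n.+1) k%:R * Z k w)
    (rho : R -> R) (rho_dickman : is_dickman rho)
    (x : R) (x_gt0 : 0 < x)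
    (kappa : nat -> int)
    (kappa_lim : (kappa n)%:~R / n%:R @[n --> \oo] --> x) :
  n%:R * fine (P (T n @^-1` [set (kappa n)%:~R])) @[n --> \oo]
    --> expR (- euler_gamma R) * rho x.
Proof.
have [rho_cont _ _] := rho_dickman.
set l := expR _.
have [N leN] : exists N : nat, x + 1 <= N.+1%:R.
  exists (Num.bound (x + 1)); rewrite ltW //.
  apply: lt_trans (archi_boundP _) _; first by lra.
  by rewrite ltr_nat.
(* [u n] is [(kappa n - 1) / n], because the value [m + 1] of [T_n] corresponds to the coefficient
   of index [m]. *)
pose u n : R := (kappa n)%:~R / n%:R - n%:R^-1.
have u_lim : u @ \oo --> x.
  have inv0 : (fun n : nat => n%:R^-1 : R) @ \oo --> (0 : R).
    by rewrite -cvg_shiftS; exact: cvg_harmonic.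
  by rewrite -[x]subr0; apply: cvgB.
have rho_u : (fun n => l * rho (u n)) @ \oo --> l * rho x.
  apply: cvgMr; apply: (continuous_cvg _ _ u_lim).
  have [/(_ x) + _] := (continuous_within_itvcyP 0 rho).1 rho_cont.
  by apply; rewrite in_itv /= x_gt0.
rewrite (_ : (fun n => _) = (fun n => n%:R * pmf R n (kappa n))); last first.
  apply/funext => n; congr (_ * _).
  rewrite (_ : T n = fun w => \sum_(1 <= k < n.+1) k%:R * Z k w).
    by rewrite pmf_law.
  exact/funext/T_def.
(* Uniformity in [pmf_coef_dickman] allows comparison at the moving point [u n]; continuity of [rho]
   at [x] does the rest. *)
suff diff0 : (fun n => n%:R * pmf R n (kappa n) - l * rho (u n)) @ \oo -->
    (0 : R).
  rewrite -[l * rho x]add0r.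
  rewrite (_ : (fun n => _) = (fun n =>
    (n%:R * pmf R n (kappa n) - l * rho (u n)) + l * rho (u n))).
    exact: cvgD.
  by apply/funext => n; rewrite subrK.
apply/cvgrPdist_le => e e_gt0.
have [M cM] := pmf_coef_dickman N rho_dickman e_gt0.
have x2_gt0 : 0 < x / 2 by rewrite divr_gt0.
near=> n.
have n_gt0 : (0 < n)%N by near: n; exact: nbhs_infty_gt.
have n0 : 0 < n%:R :> R by rewrite ltr0n.
(* The distance [x / 2] keeps [m / n] away from 0, so that [m] eventually exceeds [M]; the distance
   1 keeps it below [N.+1]. *)
have u_near : `|x - u n| <= Num.min (x / 2) 1.
  near: n; move/cvgrPdist_le : u_lim; apply.
  by rewrite lt_min x2_gt0 ltr01.
have [u_lo u_hi] : x / 2 <= u n /\ u n <= N.+1%:R.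
  move: u_near; rewrite le_min !ler_norml => /andP[/andP[a b] /andP[c d']].
  by split; lra.
have M_n : M%:R <= x / 2 * n%:R.
  rewrite mulrC -ler_pdivrMr //; near: n; exact: nbhs_infty_ger.
have unE : u n * n%:R = (kappa n)%:~R - 1.
  by rewrite /u mulrBl divfK ?mulVf // lt0r_neq0.
have [m kE] : exists m : nat, kappa n = Posz m.+1.
  have : (0 : R) < (kappa n)%:~R.
    have : 0 < u n * n%:R by rewrite mulr_gt0 //; lra.
    by rewrite unE; lra.
  by rewrite ltr0z; case: (kappa n) => [[|m]|m] // _; exists m.
have mE : u n = m%:R / n%:R.
  apply: (canRL (mulfK _)); first exact: lt0r_neq0.
  by rewrite unE kE -pmulrn -natr1 addrK.
have leMm : (M <= m)%N.
  rewrite -(ler_nat R); apply: le_trans M_n _.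
  by rewrite -ler_pdivlMr // -mE.
have lemn : (m <= N.+1 * n)%N.
  by rewrite -(ler_nat R) natrM -ler_pdivrMr // -mE.
rewrite sub0r normrN pmfE // kE mE.
exact: cM.
Unshelve. all: by end_near. Qed.
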